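(* Let $N\ge 2$, let $\mathcal{U}\subseteq\{0,1,\dots,N-1\}^{\mathbb{Z}^2}$ be a block gluing additive shift space, and let $\Omega=\{\Omega(n)\}_{n=1}^{\infty}$ be an expanding system of $\mathbb{Z}^2$ satisfying $$\limsup_{n\to\infty}\frac{|\partial\Omega(n)|}{|\Omega(n)|}=0.$$ Then $h_{\Omega}(\mathcal{U})=h_r(\mathcal{U})$.
   Context: Let $\mathcal{A}=\{0,1,\dots,N-1\}$ with $N\ge2$. An additive shift space $\mathcal{U}\subseteq\mathcal{A}^{\mathbb{Z}^2}$ is a subset that is closed (in the product topology) and invariant under all shifts $\sigma^{\mathbf{v}}$, $\mathbf{v}\in\mathbb{Z}^2$, where $(\sigma^{\mathbf{v}}(x))_{i,j}=x_{(i,j)+\mathbf{v}}$. An expanding system $\Omega=\{\Omega(n)\}_{n=1}^\infty$ of $\mathbb{Z}^2$ is a sequence of finite nonempty subsets $\Omega(n)\subset\mathbb{Z}^2$ with $\Omega(n)\subseteq\Omega(n+1)$ for all $n$ and $\bigcup_{n\ge1}\Omega(n)=\mathbb{Z}^2$. For $\mathbb{L}\subset\mathbb{Z}^2$ let $\mathcal{U}|_{\mathbb{L}}=\{x|_{\mathbb{L}}: x\in\mathcal{U}\}$; for finite $\mathbb{L}$ let $\Gamma(\mathbb{L},\mathcal{U})=|\mathcal{U}|_{\mathbb{L}}|$, and $$h_\Omega(\mathcal{U})=\limsup_{n\to\infty}\frac{1}{|\Omega(n)|}\log\Gamma(\Omega(n),\mathcal{U}).$$ For $m,n\ge1$ and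 $(i,j)\in\mathbb{Z}^2$, let $\mathbb{Z}_{m\times n}((i,j))=\{(i+n_1,j+n_2):0\le n_1\le m-1,\ 0\le n_2\le n-1\}$ and $\mathbb{Z}_{m\times n}=\mathbb{Z}_{m\times n}((0,0))$. The rectangular entropy is $$h_r(\mathcal{U})=\limsup_{m,n\to\infty}\frac{1}{mn}\log\Gamma(\mathbb{Z}_{m\times n},\mathcal{U})$$ (the limit exists and equals $\inf_{m,n\ge1}\frac1{mn}\log\Gamma(\mathbb{Z}_{m\times n},\mathcal{U})$). For finite $\mathbb{L}\subset\mathbb{Z}^2$, the interior is $\overset{\circ}{\mathbb{L}}=\{(i,j)\in\mathbb{L}: (i+1,j),(i,j+1),(i+1,j+1)\in\mathbb{L}\}$ and the boundary is $\partial\mathbb{L}=\mathbb{L}\setminus\overset{\circ}{\mathbb{L}}$. With $d$ the Euclidean metric on $\mathbb{Z}^2$ (and $d(R_1,R_2)$ the minimal distance between points of two sets), $\mathcal{U}$ is block gluing if there is a number $M=M(\mathcal{U})\ge1$ such that for any two rectangular lattices $R_1=\mathbb{Z}_{m_1\times n_1}((i_1,j_1))$, $R_2=\mathbb{Z}_{m_2\times n_2}((i_2,j_2))$ with $m_l,n_l\ge 1$, $(i_l,j_l)\in\mathbb{Z}^2$ and $d(R_1,R_2)\ge M$, and any $U_1\in\mathcal{U}|_{R_1}$, $U_2\in\mathcal{U}|_{R_2}$, there exists $W\in\mathcal{U}$ with $W|_{R_1}=U_1$ and $W|_{R_2}=U_2$. *)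

(* Defs.v *)
From HB Require Import structures.
From mathcomp Require Import all_boot all_order all_algebra finmap.
From mathcomp Require Import all_classical all_reals all_analysis.

Set Implicit Arguments.
Unset Strict Implicit.
Unset Printing Implicit Defensive.

Import Order.TTheory GRing.Theory Num.Theory.

Local Open Scope classical_set_scope.
Local Open Scope ring_scope.

Notation Z2 := (int * int)%type.

Definition config (N : nat) : topologicalType :=
  {ptws Z2 -> discrete_topology 'I_N}.

Definition shift_config (N : nat) (v : Z2) (x : config N) : config N :=
  fun w => x (w + v).

Definition additive_shift_space (N : nat) (U : set (config N)) : Prop :=
  closed U /\ forall v : Z2, shift_config v @` U = U.

Definition restr (N : nat) (L : {fset Z2}) (x : config N) : {ffun L -> 'I_N} :=
  [ffun v : L => (x (val v) : 'I_N)].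

Definition patterns (N : nat) (L : {fset Z2}) (U : set (config N)) :
    set {ffun L -> 'I_N} :=
  restr L @` U.

Arguments patterns {N} L U _.

Definition Gamma (N : nat) (L : {fset Z2}) (U : set (config N)) : nat :=
  #|` fset_set (patterns L U)|.

(* log |U restricted to L| / |L|; as lne 0 = -oo, it is -oo if U is empty and
   L is not. *)
Definition pattern_rate (R : realType) (N : nat) (L : {fset Z2})
    (U : set (config N)) : \bar R :=
  ((#|` L|%:R : R)^-1%:E * lne ((Gamma L U)%:R : R)%:E)%E.

(* Sequences are indexed from 1; the value at 0 is unconstrained. *)
Definition expanding_system (Omega : nat -> {fset Z2}) : Prop :=
  [/\ forall n, (1 <= n)%N -> Omega n != fset0,
      forall n, (1 <= n)%N -> (Omega n `<=` Omega n.+1)%fset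
    & forall v : Z2, exists2 n, (1 <= n)%N & v \in Omega n].

Definition expanding_entropy (R : realType) (N : nat) (Omega : nat -> {fset Z2})
    (U : set (config N)) : \bar R :=
  limn_esup (fun n => pattern_rate R (Omega n) U).

Definition rect_lattice (m n : nat) (v : Z2) : {fset Z2} :=
  [fset (v.1 + k%:Z, v.2 + l%:Z)%R | k in iota 0 m, l in iota 0 n]%fset.

Definition rect_entropy (R : realType) (N : nat) (U : set (config N)) :
    \bar R :=
  limf_esup (fun mn : nat * nat => pattern_rate R (rect_lattice mn.1 mn.2 (0, 0)) U)
    (filter_prod \oo \oo).

Definition lattice_interior (L : {fset Z2}) : {fset Z2} :=
  [fset v in L | [&& (v.1 + 1, v.2)%R \in L, (v.1, v.2 + 1)%R \in L
                   & (v.1 + 1, v.2 + 1)%R \in L]]%fset.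

Definition lattice_boundary (L : {fset Z2}) : {fset Z2} :=
  (L `\` lattice_interior L)%fset.

Definition euclid_dist (R : realType) (p q : Z2) : R :=
  Num.sqrt (((p.1 - q.1)%:~R) ^+ 2 + ((p.2 - q.2)%:~R) ^+ 2).

Definition set_dist (R : realType) (A B : {fset Z2}) : R :=
  inf [set euclid_dist R p q | p in [set` A] & q in [set` B]].

Definition block_gluing (R : realType) (N : nat) (U : set (config N)) : Prop :=
  exists2 M : R, 1 <= M &
    forall (m1 n1 m2 n2 : nat) (v1 v2 : Z2),
      (1 <= m1)%N -> (1 <= n1)%N -> (1 <= m2)%N -> (1 <= n2)%N ->
      let R1 := rect_lattice m1 n1 v1 in
      let R2 := rect_lattice m2 n2 v2 in
      M <= set_dist R R1 R2 ->
      forall (U1 : {ffun R1 -> 'I_N}) (U2 : {ffun R2 -> 'I_N}),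
        patterns R1 U U1 -> patterns R2 U U2 ->
        exists W : config N, [/\ U W, restr R1 W = U1 & restr R2 W = U2].

(* Main.v *)
(** Both entropies are squeezed, up to an arbitrarily small error, by the same
    number [ln Gamma(k x k) / k^2].  Let [L] be a finite set whose boundary is
    small relative to [L].  By pigeonhole over the residue classes mod [p] of
    the anchors [v] with [v + [0,p)^2] inside [L], some translate of the tiling
    by [p x p] squares has about [|L| / p^2] tiles inside [L].  With [p = k],
    subadditivity of [ln Gamma] gives [ln Gamma(L) / |L| <= ln Gamma(k x k) / k^2 + o(1)].
    With [p = k + M], block gluing lets one prescribe independently the patterns
    on the [k x k] corners of these tiles, which gives
    [ln Gamma(L) / |L| >= ln Gamma(k x k) / (k + M)^2 - o(1)].  The two bounds are
    close for large [k], and they apply to [Omega(n)] as well as to rectangles. *)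
Require Import Defs.
From HB Require Import structures.
From mathcomp Require Import all_boot all_order all_algebra finmap.
From mathcomp Require Import all_classical all_reals all_analysis.
From mathcomp Require Import zify ring lra.

Set Implicit Arguments.
Unset Strict Implicit.
Unset Printing Implicit Defensive.

Import Order.TTheory GRing.Theory Num.Theory.

Local Open Scope classical_set_scope.
Local Open Scope ring_scope.

(** * Rectangles and their boundaries *)

Lemma in_rect (m n : nat) (v w : Z2) :
  (w \in rect_lattice m n v) =
  [&& v.1 <= w.1, w.1 < v.1 + m%:Z, v.2 <= w.2 & w.2 < v.2 + n%:Z].
Proof.
apply/imfset2P/idP => [[k /=] | ].
  rewrite mem_iota => hk [l /=]; rewrite mem_iota => hl -> /=; lia.
case: w => w1 w2 /= hw; exists `|w1 - v.1|%N; first by rewrite /= mem_iota; lia.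
exists `|w2 - v.2|%N; first by rewrite /= mem_iota; lia.
congr pair; lia.
Qed.

Lemma card_rect (m n : nat) (v : Z2) : #|` rect_lattice m n v| = (m * n)%N.
Proof.
set s := [seq (v.1 + k%:Z, v.2 + l%:Z) | k <- iota 0 m, l <- iota 0 n].
have us : uniq s.
  apply: allpairs_uniq; [exact: iota_uniq|exact: iota_uniq|].
  by move=> [a b] [a' b'] _ _ /= [] /addrI[->] /addrI[->].
have /perm_size -> : perm_eq (rect_lattice m n v) s.
  apply: uniq_perm => // w; apply/imfset2P/allpairsP => [[k /= hk [l /= hl ->]]|].
    by exists (k, l).
  by case=> -[k l] /= [hk hl ->]; exists k => //; exists l.
by rewrite size_allpairs !size_iota.
Qed.

(** The interior looks only up and to the right, so the boundary lies in the last row and the last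
    column. *)
Lemma boundary_rect (m n : nat) (v : Z2) :
  (#|` lattice_boundary (rect_lattice m n v)| <= m + n)%N.
Proof.
have sub : (rect_lattice m.-1 n.-1 v `<=` rect_lattice m n v)%fset.
  by apply/fsubsetP => w; rewrite !in_rect; lia.
apply: (@leq_trans #|` (rect_lattice m n v `\` rect_lattice m.-1 n.-1 v)%fset|).
  apply/fsubset_leq_card/fsetDS/fsubsetP => w; rewrite in_rect => hw.
  rewrite in_fset !inE /= !in_rect /=; lia.
rewrite cardfsDS// !card_rect; case: m {sub} => [|m]; case: n => [|n] /=; lia.
Qed.

(* The interior looks only up and to the right, so a rectangle whose lower left
   corner is in [L] and which misses the boundary is filled by moving along its
   first row and then upwards. *)
Lemma rect_subset (m n : nat) (v : Z2) (L : {fset Z2}) : v \in L ->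
  (forall u, u \in lattice_boundary L -> u \notin rect_lattice m n v) ->
  (rect_lattice m n v `<=` L)%fset.
Proof.
move=> vL bd.
have step u : u \in L -> u \in rect_lattice m n v ->
    ((u.1 + 1, u.2) \in L) && ((u.1, u.2 + 1) \in L).
  move=> uL uR; apply/contraT => h; have := bd u; rewrite uR; apply.
  rewrite in_fsetD uL andbT in_fset !inE /= uL /=.
  by apply: contra h => /and3P[-> ->].
have row a : (a < m)%N -> (0 < n)%N -> (v.1 + a%:Z, v.2) \in L.
  elim: a => [|a IH] am n0; first by rewrite addr0 -surjective_pairing.
  have /andP[+ _] := step _ (IH (ltnW am) n0) (ltac:(rewrite in_rect /=; lia)).
  by rewrite /= -addrA -PoszD addn1.
have cell a b : (a < m)%N -> (b < n)%N -> (v.1 + a%:Z, v.2 + b%:Z) \in L.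
  move=> am; elim: b => [|b IH] bn; first by rewrite addr0; apply: row.
  have /andP[_] := step _ (IH (ltnW bn)) (ltac:(rewrite in_rect /=; lia)).
  by rewrite /= -addrA -PoszD addn1.
apply/fsubsetP => w /imfset2P[k /= + [l /= + ->]].
by rewrite !mem_iota; apply: cell.
Qed.

(** * Packing disjoint squares into a finite set *)

(** By [rect_subset] the square at a bad anchor contains a boundary point, and each boundary point
    lies in only [p * p] such squares. *)
Lemma count_bad_anchors (p : nat) (L : {fset Z2}) :
  (count (fun v => ~~ (rect_lattice p p v `<=` L)%fset) L
    <= p * p * #|` lattice_boundary L|)%N.
Proof.
pose s := [seq (u.1 - ab.1%:Z, u.2 - ab.2%:Z) | u <- enum_fset (lattice_boundary L),
  ab <- [seq (a, b) | a <- iota 0 p, b <- iota 0 p]] : seq Z2.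
have -> : (p * p * #|` lattice_boundary L| = size s)%N.
  by rewrite !size_allpairs !size_iota mulnC.
rewrite -size_filter; apply: uniq_leq_size; first by rewrite filter_uniq ?fset_uniq.
move=> [v1 v2]; rewrite mem_filter => /andP[bad vL].
have [[u1 u2] uB uR] : exists2 u, u \in lattice_boundary L & u \in rect_lattice p p (v1, v2).
  apply: contrapT => h; move/negP: bad; apply; apply: rect_subset => // u uB.
  by apply/negP => uR; apply: h; exists u.
apply/allpairsP; move: uR; rewrite in_rect /= => uR.
exists ((u1, u2), (`|u1 - v1|%N, `|u2 - v2|%N)); split => //=.
  by apply: allpairs_f; rewrite mem_iota; lia.
by apply: (@f_equal2 int int); lia.
Qed.

Definition grid_point (c : Z2) (p : nat) (ij : nat * nat) : Z2 :=
  (c.1 + (p * ij.1)%:Z, c.2 + (p * ij.2)%:Z).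

(** Good anchors split into [p * p] residue classes; the largest class supplies [I], and the
    boundary term pays for the bad anchors. *)
Lemma square_packing (p : nat) (L : {fset Z2}) : (0 < p)%N ->
  exists (c : Z2) (n : nat) (I : {set 'I_n * 'I_n}),
    (forall ij, ij \in I ->
      (rect_lattice p p (grid_point c p (ij.1 : nat, ij.2 : nat)) `<=` L)%fset) /\
    (#|` L| <= p * p * (#|I| + #|` lattice_boundary L|))%N.
Proof.
(* Measured from the origin [(-B, -B)], points of [L] have coordinates between 0 and [2 * B], so
   grid indices stay below [n]. *)
move=> p0; pose B := (\max_(v <- enum_fset L) (`|v.1| + `|v.2|))%N.
pose s : Z2 := (- B%:Z, - B%:Z); pose n := (2 * B).+1.
have HB v : v \in L -> (`|v.1| + `|v.2| <= B)%N.
  by move=> vL; exact: (leq_bigmax_seq v vL isT).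
pose off (r : 'I_p * 'I_p) : Z2 := (s.1 + r.1%:Z, s.2 + r.2%:Z).
pose I r := [set ij : 'I_n * 'I_n |
  (rect_lattice p p (grid_point (off r) p (ij.1 : nat, ij.2 : nat)) `<=` L)%fset]%SET.
pose pt r (ij : 'I_n * 'I_n) := grid_point (off r) p (ij.1 : nat, ij.2 : nat).
pose t := [seq pt r ij | r <- enum (('I_p * 'I_p)%type : finType), ij <- enum (I r)].
pose r0 : 'I_p * 'I_p := (Ordinal p0, Ordinal p0).
have [r _ rmax] := @arg_maxnP _ r0 xpredT (fun r => #|I r|) isT.
exists (off r), n, (I r); split => [ij|]; first by rewrite inE.
have st : (size t <= p * p * #|I r|)%N.
  rewrite size_allpairs_dep sumnE big_map.
  apply: (@leq_trans (\sum_(i <- enum (('I_p * 'I_p)%type : finType)) #|I r|)).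
    by apply: leq_sum => i _; rewrite -cardE; apply: rmax.
  by rewrite big_const_seq count_predT -cardE card_prod !card_ord iter_addn_0 mulnC.
rewrite mulnDr -(count_predC (fun v => rect_lattice p p v `<=` L)%fset L).
apply: leq_add; last exact: count_bad_anchors.
apply: leq_trans st; rewrite -size_filter.
apply: uniq_leq_size; first by rewrite filter_uniq ?fset_uniq.
move=> [v1 v2]; rewrite mem_filter => /andP[good vL].
have /= hv := HB _ vL.
pose a1 := absz (v1 + B%:Z); pose a2 := absz (v2 + B%:Z).
have d1 : (a1 %/ p < n)%N by apply: leq_ltn_trans (leq_div _ _) _; lia.
have d2 : (a2 %/ p < n)%N by apply: leq_ltn_trans (leq_div _ _) _; lia.
(* Remainders give the residue class of the anchor, quotients its cell in the grid. *)
pose rv : 'I_p * 'I_p := (Ordinal (ltn_pmod a1 p0), Ordinal (ltn_pmod a2 p0)).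
have vE : (v1, v2) = grid_point (off rv) p (a1 %/ p, a2 %/ p)%N.
  rewrite /grid_point /off /=.
  have e1 := divn_eq a1 p; have e2 := divn_eq a2 p.
  by apply: (@f_equal2 int int); rewrite mulnC; lia.
apply/allpairsPdep; exists rv, (Ordinal d1, Ordinal d2).
by rewrite !mem_enum !inE /pt /= -vE.
Qed.

(** The squares are disjoint: Euclidean division by [p] recovers the cell and the offset of a
    point. *)
Lemma card_grid_squares (p : nat) (c : Z2) (n : nat) (I : {set 'I_n * 'I_n}) :
  (p * p * #|I| <= #|` (\bigcup_(ij in I)
    rect_lattice p p (grid_point c p (ij.1 : nat, ij.2 : nat)))%fset|)%N.
Proof.
pose pt (ij : 'I_n * 'I_n) (ab : nat * nat) : Z2 :=
  (c.1 + (p * ij.1 + ab.1)%:Z, c.2 + (p * ij.2 + ab.2)%:Z).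
pose ab := [seq (a, b) | a <- iota 0 p, b <- iota 0 p].
pose s := [seq pt ij x | ij <- enum I, x <- ab].
have -> : (p * p * #|I| = size s)%N.
  by rewrite !size_allpairs !size_iota -cardE mulnC.
apply: uniq_leq_size; last first.
  move=> _ /allpairsP[[ij _] [/= ijI /allpairsP[[a b] [/= + + ->]] ->]].
  rewrite !mem_iota => ha hb; apply/bigfcupP; exists ij.
    by rewrite mem_index_enum -mem_enum.
  by rewrite in_rect /pt /grid_point /=; lia.
apply: allpairs_uniq.
- exact: enum_uniq.
- by apply: allpairs_uniq => [||[? ?] [? ?]]; rewrite ?iota_uniq.
have abP q : q \in [seq (x, y) | x <- enum I, y <- ab] -> (q.2.1 < p)%N /\ (q.2.2 < p)%N.
  move=> /allpairsP[[x y] [_ /= /allpairsP[[a b] /= [+ + ->]] ->]] /=.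
  by rewrite !mem_iota.
move=> [[i1 i2] [a b]] [[k1 k2] [a' b']] /abP[/= ha hb] /abP[/= ha' hb'] [].
have euclid (x y u w : nat) (z : int) : (u < p)%N -> (w < p)%N ->
    z + (p * x + u)%:Z = z + (p * y + w)%:Z -> x = y /\ u = w.
  move=> up wp /addrI [e]; have p0 : (0 < p)%N by apply: leq_ltn_trans up.
  have := congr1 (divn^~ p) e; rewrite !(mulnC p) !divnMDl// !divn_small// !addn0.
  by move=> xy; split => //; move: e; rewrite xy => /addnI.
by move=> /(euclid _ _ _ _ _ ha ha')[/val_inj -> ->] /(euclid _ _ _ _ _ hb hb')[/val_inj -> ->].
Qed.

(** * Counting patterns; upper bound by subadditivity *)

Lemma card_image_factor (X : Type) (T1 T2 : finType) (U : set X)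
    (f : X -> T1) (g : X -> T2) :
  (forall x y, U x -> U y -> g x = g y -> f x = f y) ->
  (#|[set t | `[< (f @` U) t >]]%SET| <= #|[set t | `[< (g @` U) t >]]%SET|)%N.
Proof.
move=> fg; have [->|/set0P[x0 Ux0]] := eqVneq U set0; rewrite ?image_set0.
  by rewrite [leqLHS]eq_card0// => t; rewrite !inE; apply/asboolP.
(* [h] chooses a preimage of each attained value, with [x0] as default; [g \o h] is then injective
   on the image of [f]. *)
have /choice[h hP] : forall t, exists x, U x /\ ((f @` U) t -> f x = t).
  move=> t; have [[x Ux <-]|nt] := pselect ((f @` U) t); first by exists x.
  by exists x0; split.
rewrite -(@card_in_imset _ _ (g \o h)) => [|t t' + + e].
  apply/subset_leq_card/fintype.subsetP => _ /imsetP[t _ ->].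
  by rewrite inE; apply/asboolP; exists (h t) => //; case: (hP t).
rewrite !inE => ft ft'.
have [[Ut ht] [Ut' ht']] := (hP t, hP t').
by rewrite -(ht ft) -(ht' ft'); apply: fg.
Qed.

Section Patterns.
Variable N : nat.
Implicit Types (U : set (config N)) (L : {fset Z2}) (x y : config N).

Lemma restrP L x y :
  restr L x = restr L y <-> forall v, v \in L -> x v = y v.
Proof.
split => [/ffunP e v vL|e]; first by have := e [` vL]%fset; rewrite !ffunE.
by apply/ffunP => v; rewrite !ffunE; apply: e; apply: valP.
Qed.

Lemma GammaE L U :
  Gamma L U = #|[set t : {ffun L -> 'I_N} | `[< patterns L U t >]]%SET|.
Proof.
rewrite /Gamma cardE; apply/perm_size/uniq_perm => [||t].
- exact: fset_uniq.
- exact: enum_uniq.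
rewrite mem_enum inE in_fset_set; first exact/idP/idP.
exact: finite_finset.
Qed.

Lemma Gamma_gt0 L U : U !=set0 -> (0 < Gamma L U)%N.
Proof.
move=> [x Ux]; rewrite GammaE card_gt0; apply/set0Pn; exists (restr L x).
by rewrite inE; apply/asboolP; exists x.
Qed.

Lemma Gamma_le_exp L U : (Gamma L U <= N ^ #|` L|)%N.
Proof.
rewrite GammaE; apply: leq_trans (max_card _) _.
by rewrite card_ffun card_ord cardfE.
Qed.

Lemma Gamma_mono L L' U : (L `<=` L')%fset -> (Gamma L U <= Gamma L' U)%N.
Proof.
move=> /fsubsetP LL'; rewrite !GammaE; apply: card_image_factor => x y _ _.
by move=> /restrP e; apply/restrP => v /LL'; apply: e.
Qed.

Lemma Gamma_fsetU L L' U : (Gamma (L `|` L')%fset U <= Gamma L U * Gamma L' U)%N.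
Proof.
rewrite !GammaE -cardsX.
apply: leq_trans (@card_image_factor _ _ _ U _ (fun x => (restr L x, restr L' x)) _) _.
  move=> x y _ _ [] /restrP e /restrP e'; apply/restrP => v.
  by rewrite in_fsetU => /orP[/e|/e'].
apply/subset_leq_card/fintype.subsetP => t; rewrite !inE => -[x Ux <-] /=.
by apply/andP; split; apply/asboolP; exists x.
Qed.

Lemma Gamma_rect_shift U (m n : nat) (v : Z2) : shift_config (- v) @` U = U ->
  (Gamma (rect_lattice m n v) U <= Gamma (rect_lattice m n (0, 0)%R) U)%N.
Proof.
move=> sU; rewrite !GammaE /patterns -[in X in (X <= _)%N]sU image_comp.
apply: card_image_factor => x y _ _ /restrP e; apply/restrP => w.
rewrite in_rect /= => hw; apply: e; rewrite in_rect /=; lia.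
Qed.

Lemma Gamma_bigfcup (I : Type) (s : seq I) (P : pred I) (F : I -> {fset Z2}) U :
  (Gamma (\bigcup_(i <- s | P i) F i)%fset U <= \prod_(i <- s | P i) Gamma (F i) U)%N.
Proof.
elim/big_ind2: _ => [|L g L' g' h h'|//].
- by have := Gamma_le_exp fset0 U; rewrite cardfs0.
- exact: leq_trans (Gamma_fsetU _ _ _) (leq_mul h h').
Qed.

(** Each tile contributes at most the count of the square at the origin, by shift invariance; each
    cell outside the disjoint tiles contributes at most [N]. *)
Lemma Gamma_le_packing U (k : nat) (L : {fset Z2}) (c : Z2) (n : nat)
    (I : {set 'I_n * 'I_n}) :
  (forall v, shift_config v @` U = U) ->
  (forall ij, ij \in I ->
    (rect_lattice k k (grid_point c k (ij.1 : nat, ij.2 : nat)) `<=` L)%fset) ->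
  (0 < N)%N ->
  (Gamma L U <= Gamma (rect_lattice k k (0, 0)%R) U ^ #|I|
     * N ^ (#|` L| - k * k * #|I|))%N.
Proof.
move=> sU IL N0.
set D := (\bigcup_(ij in I) rect_lattice k k (grid_point c k (ij.1 : nat, ij.2 : nat)))%fset.
have DL : (D `<=` L)%fset.
  by apply/bigfcupsP => ij _; apply: IL.
have LE : L = (D `|` (L `\` D))%fset.
  apply/fsetP => v; rewrite in_fsetU in_fsetD.
  by case: (boolP (v \in D)) => //= /(fsubsetP DL).
rewrite [X in Gamma X _]LE; apply: leq_trans (Gamma_fsetU _ _ _) (leq_mul _ _).
  apply: leq_trans (Gamma_bigfcup _ _ _ _) _.
  rewrite -prod_nat_const; apply: leq_prod => ij _; exact: Gamma_rect_shift.
apply: leq_trans (Gamma_le_exp _ _) _; rewrite leq_pexp2l//.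
by rewrite cardfsDS// leq_sub2l// card_grid_squares.
Qed.

End Patterns.

(** * Gluing patterns on a grid of separated squares *)

Lemma set_dist_ge (R : realType) (M : R) (A B : {fset Z2}) :
  A != fset0 -> B != fset0 ->
  (forall p q, p \in A -> q \in B ->
    M <= `|(p.1 - q.1)%:~R| \/ M <= `|(p.2 - q.2)%:~R|) ->
  M <= set_dist R A B.
Proof.
move=> /fset0Pn[a aA] /fset0Pn[b bB] AB; apply: lb_le_inf.
  by exists (euclid_dist R a b); exists a => //; exists b.
move=> _ [p pA [q qB <-]]; rewrite /euclid_dist.
by case: (AB p q pA qB) => /le_trans; apply; rewrite -sqrtr_sqr ler_wsqrtr//;
  rewrite ?lerDl ?lerDr sqr_ge0.
Qed.

Lemma rect_neq0 (m n : nat) (v : Z2) : (0 < m)%N -> (0 < n)%N ->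
  rect_lattice m n v != fset0.
Proof. by move=> m0 n0; rewrite -cardfs_gt0 card_rect muln_gt0 m0. Qed.

(* The gap [M] is measured along one coordinate, which bounds the Euclidean
   distance from below. *)
Lemma block_gluing_configs (R : realType) (N : nat) (U : set (config N)) :
  block_gluing R U -> exists M : nat, forall (m1 n1 m2 n2 : nat) (v1 v2 : Z2),
    (0 < m1)%N -> (0 < n1)%N -> (0 < m2)%N -> (0 < n2)%N ->
    v1.1 + m1%:Z + M%:Z <= v2.1 \/ v1.2 + n1%:Z + M%:Z <= v2.2 ->
    forall x y : config N, U x -> U y ->
    exists2 W : config N, U W &
      (forall v, v \in rect_lattice m1 n1 v1 -> W v = x v) /\
      (forall v, v \in rect_lattice m2 n2 v2 -> W v = y v).
Proof.
move=> [M M1 glue]; exists (Num.bound M) => m1 n1 m2 n2 v1 v2 m10 n10 m20 n20 sep x y Ux Uy.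
have MB : M <= (Num.bound M)%:R by apply/ltW/archi_boundP/(le_trans ler01).
have far (z : int) : (Num.bound M)%:Z <= - z -> M <= `|z%:~R|.
  move=> hz; apply: le_trans MB _; rewrite -normrN -rmorphN /=.
  by apply: le_trans (ler_norm _); rewrite (ler_int R (Num.bound M)).
have [|W [UW /restrP Wx /restrP Wy]] :=
  glue m1 n1 m2 n2 v1 v2 m10 n10 m20 n20 _ _ _ (ex_intro2 _ _ x Ux erefl) (ex_intro2 _ _ y Uy erefl).
  apply: set_dist_ge; rewrite ?rect_neq0// => -[p1 p2] [q1 q2]; rewrite !in_rect /= => hp hq.
  by case: sep => sep; [left|right]; apply: far; lia.
by exists W.
Qed.

Section Gluing.
Variables (N : nat) (U : set (config N)) (M : nat).
Hypothesis glue : forall (m1 n1 m2 n2 : nat) (v1 v2 : Z2),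
  (0 < m1)%N -> (0 < n1)%N -> (0 < m2)%N -> (0 < n2)%N ->
  v1.1 + m1%:Z + M%:Z <= v2.1 \/ v1.2 + n1%:Z + M%:Z <= v2.2 ->
  forall x y : config N, U x -> U y ->
  exists2 W : config N, U W &
    (forall v, v \in rect_lattice m1 n1 v1 -> W v = x v) /\
    (forall v, v \in rect_lattice m2 n2 v2 -> W v = y v).

(* Block gluing only joins two rectangles.  The pattern obtained so far is
   extended to the rectangle hull of the squares already placed, which is then
   glued to the next square of the row, and later to the next row. *)
Lemma glue_row (k : nat) (c : Z2) (j m : nat) (f : nat -> config N) :
  (0 < k)%N -> (forall i, U (f i)) ->
  exists2 W, U W & forall i v, (i <= m)%N ->
    v \in rect_lattice k k (grid_point c (k + M) (i, j)) -> W v = f i v.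
Proof.
move=> k0 Uf; elim: m => [|m [x Ux xf]].
  by exists (f 0%N) => // i v; rewrite leqn0 => /eqP ->.
have [||W UW [Wx Wf]] := @glue ((k + M) * m + k) k k k
  (grid_point c (k + M) (0%N, j)) (grid_point c (k + M) (m.+1, j))
  _ k0 k0 k0 _ x (f m.+1) Ux (Uf _).
- by rewrite addn_gt0 k0 orbT.
- by left; rewrite /grid_point /=; lia.
exists W => // i v; rewrite leq_eqVlt => /predU1P[-> /Wf//|im vi].
rewrite Wx ?(xf i)//; move: vi; rewrite !in_rect /grid_point /=.
have := leq_mul (leqnn (k + M)) im; lia.
Qed.

(** Rows are stacked upwards: the hull of rows 0 to [n] ends exactly [M] below row [n.+1]. *)
Lemma glue_grid (k : nat) (c : Z2) (n m : nat) (f : nat -> nat -> config N) :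
  (0 < k)%N -> (forall i j, U (f i j)) ->
  exists2 W, U W & forall i j v, (i <= m)%N -> (j <= n)%N ->
    v \in rect_lattice k k (grid_point c (k + M) (i, j)) -> W v = f i j v.
Proof.
move=> k0 Uf; elim: n => [|n [x Ux xf]].
  have [W UW Wf] := @glue_row k c 0 m (f^~ 0%N) k0 (Uf^~ _).
  by exists W => // i j v im; rewrite leqn0 => /eqP ->; apply: Wf.
have [y Uy yf] := @glue_row k c n.+1 m (f^~ n.+1) k0 (Uf^~ _).
have l0 : (0 < (k + M) * m + k)%N by rewrite addn_gt0 k0 orbT.
have [||W UW [Wx Wy]] := @glue ((k + M) * m + k) ((k + M) * n + k) ((k + M) * m + k) k
  (grid_point c (k + M) (0%N, 0%N)) (grid_point c (k + M) (0%N, n.+1))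
  l0 _ l0 k0 _ x y Ux Uy.
- by rewrite addn_gt0 k0 orbT.
- by right; rewrite /grid_point /=; lia.
exists W => // i j v im; have := leq_mul (leqnn (k + M)) im => im'.
rewrite leq_eqVlt => /predU1P[->|jn] vi.
  by rewrite Wy ?(yf i)//; move: vi; rewrite !in_rect /grid_point /=; lia.
rewrite Wx ?(xf i j)//; move: vi; rewrite !in_rect /grid_point /=.
have := leq_mul (leqnn (k + M)) jn; lia.
Qed.

(** Any family of [k] by [k] patterns indexed by [I] appears on the lower left corners of the tiles
    in one point of [U]; these corners lie in [L], so distinct families give distinct patterns on
    [L]. *)
Lemma Gamma_ge_packing (k : nat) (L : {fset Z2}) (c : Z2) (n : nat)
    (I : {set 'I_n * 'I_n}) : U !=set0 ->
  (forall v x, U x -> U (shift_config v x)) -> (0 < k)%N ->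
  (forall ij, ij \in I -> (rect_lattice (k + M) (k + M)
     (grid_point c (k + M) (ij.1 : nat, ij.2 : nat)) `<=` L)%fset) ->
  (Gamma (rect_lattice k k (0, 0)%R) U ^ #|I| <= Gamma L U)%N.
Proof.
move=> [x0 Ux0] sU k0 IL; set P := rect_lattice k k (0, 0).
pose g (ij : 'I_n * 'I_n) := grid_point c (k + M) (ij.1 : nat, ij.2 : nat).
(* A family is encoded as a function on the whole grid, equal to the pattern of [x0] outside [I]. *)
rewrite !GammaE -(card_pffun_on (restr P x0)).
set F := pffun_on _ _ _.
have FP (phi : {ffun 'I_n * 'I_n -> {ffun P -> 'I_N}}) : phi \in F ->
    forall ij, patterns P U (phi ij).
  move=> /pffun_onP[/fintype.subsetP supp im] ij.
  have [ijI|ijI] := boolP (ij \in I).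
    by have := im _ (fintype.image_f phi ijI); rewrite inE => /asboolP.
  have : ij \notin (restr P x0).-support phi by apply: contra ijI => /supp.
  by rewrite inE negbK => /eqP ->; exists x0.
have /choice[h hP] : forall phi, exists W, phi \in F ->
    U W /\ forall ij, restr P (shift_config (g ij) W) = phi ij.
  move=> phi; have [phiF|] := boolP (phi \in F); last by exists x0.
  have /choice[y yP] : forall ij, exists x, U x /\ restr P x = phi ij.
    by move=> ij; have [x Ux xE] := FP _ phiF ij; exists x.
  (* The shift moves the pattern of [y (i, j)] from the origin to its tile; indices off the grid get
     [x0]. *)
  pose f i j : config N :=
    if insub i is Some i' then if insub j is Some j'
    then shift_config (- g (i', j')) (y (i', j')) else x0 else x0.
  have Uf i j : U (f i j).
    rewrite /f; case: insub => // i'; case: insub => // j'.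
    by apply: sU; case: (yP (i', j')).
  have [W UW Wf] := @glue_grid k c n n f k0 Uf.
  exists W => _; split=> // -[i j]; rewrite -(yP (i, j)).2.
  apply/restrP => v vP; rewrite /shift_config /=.
  rewrite (Wf i j) ?(ltnW (ltn_ord _))//.
    by rewrite /f !valK /shift_config addrK.
  by move: vP; rewrite !in_rect /g /=; lia.
rewrite -(@card_in_imset _ _ (fun phi => restr L (h phi))) => [|phi psi phiF psiF /restrP e].
  apply/subset_leq_card/fintype.subsetP => _ /imsetP[phi phiF ->].
  by rewrite inE; apply/asboolP; exists (h phi) => //; case: (hP _ phiF).
apply/ffunP => ij; have [ijI|ijI] := boolP (ij \in I).
  rewrite -((hP _ phiF).2 ij) -((hP _ psiF).2 ij); apply/restrP => v vP.
  apply: e; apply: (fsubsetP (IL _ ijI)); move: vP.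
  by rewrite !in_rect /g /=; lia.
have out phi' : phi' \in F -> phi' ij = restr P x0.
  move=> /pffun_onP[/fintype.subsetP supp _]; apply/eqP.
  by apply: contraNT ijI => h'; apply: supp; rewrite inE.
by rewrite !out.
Qed.

End Gluing.

(** * Two-sided bounds for the logarithm of the pattern count *)

Section Bounds.
Variables (R : realType) (N : nat) (U : set (config N)).
Hypotheses (U0 : U !=set0) (shiftU : forall v, shift_config v @` U = U).

Let lnG L : R := ln (Gamma L U)%:R.
Let sq k := rect_lattice k k (0, 0).

Lemma alphabet_gt0 : (0 < N)%N.
Proof. by have [x _] := U0; apply: leq_ltn_trans (ltn_ord (x (0, 0) : 'I_N)). Qed.

Lemma lnN_ge0 : 0 <= ln (N%:R : R).
Proof. by rewrite ln_ge0// ler1n alphabet_gt0. Qed.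

Lemma lnGamma_ge0 L : 0 <= lnG L.
Proof. by rewrite ln_ge0// ler1n Gamma_gt0. Qed.

Lemma lnGamma_le L : lnG L <= #|` L|%:R * ln N%:R.
Proof.
have N0 := alphabet_gt0.
rewrite mulr_natl -lnXn ?ltr0n// -natrX ler_ln ?posrE ?ltr0n ?expn_gt0 ?N0 ?Gamma_gt0//.
by rewrite ler_nat Gamma_le_exp.
Qed.

(** Packing with [p = k] leaves at most [k * k] times the boundary uncovered. Multiplying through by
    [k * k] avoids division and squares this factor in the error term. *)
Lemma lnGamma_upper (k : nat) L : (0 < k)%N ->
  (k * k)%:R * lnG L <= #|` L|%:R * lnG (sq k) +
    (k * k)%:R ^+ 2 * #|` lattice_boundary L|%:R * ln N%:R.
Proof.
move=> k0; have N0 := alphabet_gt0.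
have [c [n [I [IL cardL]]]] := square_packing L k0.
have kIL : (k * k * #|I| <= #|` L|)%N.
  apply: leq_trans (card_grid_squares k c I) _; apply/fsubset_leq_card/bigfcupsP.
  by move=> ij _; apply: IL.
have h : lnG L <= #|I|%:R * lnG (sq k) + (#|` L| - k * k * #|I|)%:R * ln N%:R.
  rewrite !mulr_natl -!lnXn ?ltr0n ?Gamma_gt0// -lnM ?posrE ?exprn_gt0 ?ltr0n ?Gamma_gt0//.
  rewrite -!natrX -natrM ler_ln ?posrE ?ltr0n ?muln_gt0 ?expn_gt0 ?N0 ?Gamma_gt0//.
  by rewrite ler_nat (Gamma_le_packing shiftU IL).
have h2 : (k * k * #|I|)%:R * lnG (sq k) <= #|` L|%:R * lnG (sq k).
  by rewrite ler_wpM2r ?lnGamma_ge0// ler_nat.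
have h3 : (#|` L| - k * k * #|I|)%:R * ln N%:R <=
    (k * k * #|` lattice_boundary L|)%:R * ln (N%:R : R).
  by rewrite ler_wpM2r ?lnN_ge0// ler_nat leq_subLR -mulnDr.
apply: le_trans (ler_wpM2l (ler0n _ (k * k)) (le_trans h (lerD (lexx _) h3))) _.
rewrite mulrDr mulrA -natrM; apply: lerD => //.
by rewrite natrM; lra.
Qed.

(** Packing with [p = k + M]. The gap [M] is fixed before [k], so that [k] can later be taken large
    compared with it. *)
Lemma lnGamma_lower : block_gluing R U ->
  exists M : nat, forall (k : nat) L, (0 < k)%N ->
  #|` L|%:R * lnG (sq k) <=
    ((k + M) * (k + M))%:R * (lnG L + #|` lattice_boundary L|%:R * lnG (sq k)).
Proof.
move=> /block_gluing_configs[M glue]; exists M => k L k0.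
have p0 : (0 < k + M)%N by rewrite addn_gt0 k0.
have [c [n [I [IL cardL]]]] := square_packing L p0.
have h : #|I|%:R * lnG (sq k) <= lnG L.
  rewrite mulr_natl -lnXn ?ltr0n ?Gamma_gt0// -natrX ler_ln ?posrE ?ltr0n ?expn_gt0 ?Gamma_gt0//.
  rewrite ler_nat; apply: (Gamma_ge_packing glue) IL => // v x Ux.
  by rewrite -(shiftU v); exists x.
have h2 : #|` L|%:R * lnG (sq k) <=
    ((k + M) * (k + M) * (#|I| + #|` lattice_boundary L|))%:R * lnG (sq k).
  by rewrite ler_wpM2r ?lnGamma_ge0// ler_nat.
apply: le_trans h2 _; rewrite natrM natrD -mulrA ler_wpM2l// mulrDl.
exact: lerD.
Qed.

Lemma pattern_rate_fin L : pattern_rate R L U = (lnG L / #|` L|%:R)%:E.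
Proof.
by rewrite /pattern_rate lne_EFin ?ltr0n ?Gamma_gt0// -EFinM mulrC.
Qed.

(** Here [c] is the rate of one large square and depends on [e] but not on [L], so it serves both
    entropies. *)
Lemma pattern_rate_close (e : R) : block_gluing R U -> 0 < e ->
  exists c d : R, 0 < d /\ forall L, L != fset0 ->
    #|` lattice_boundary L|%:R <= d * #|` L|%:R ->
    ((c - e)%:E <= pattern_rate R L U)%E /\ (pattern_rate R L U <= (c + e)%:E)%E.
Proof.
move=> /lnGamma_lower[M low] e0; set l := ln (N%:R : R).
have l0 : 0 <= l := lnN_ge0.
(* Chosen so that [2 * M * l / k] is at most [e / 2], which bounds the loss in [gap]. *)
pose k := (Num.bound (4 * M%:R * l / e)).+1.
have k0 : (0 < k)%N by [].
have kR0 : 0 < k%:R :> R by rewrite ltr0n.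
have kM : 4 * M%:R * l <= e * k%:R.
  have b0 : 0 <= 4 * M%:R * l / e by rewrite !mulr_ge0// invr_ge0 ltW.
  rewrite [leRHS]mulrC -ler_pdivrMr//; apply/ltW/(lt_le_trans (archi_boundP b0)).
  by rewrite /k ler_nat.
set a := lnG (sq k).
have a0 : 0 <= a by apply: lnGamma_ge0.
have al : a <= k%:R ^+ 2 * l.
  by apply: le_trans (lnGamma_le _) _; rewrite card_rect natrM.
have M0 : 0 <= M%:R :> R by [].
(* [d] makes the boundary error at most [e / 2]; [l + 1] keeps the denominator positive when
   [N = 1]. *)
exists (a / k%:R ^+ 2), (e / (2 * k%:R ^+ 2 * (l + 1))).
have D0 : 0 < 2 * k%:R ^+ 2 * (l + 1) by rewrite !mulr_gt0 ?exprn_gt0// ltr_wpDl.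
split=> [|L L0 bL]; first by rewrite divr_gt0.
have cL : 0 < #|` L|%:R :> R by rewrite ltr0n cardfs_gt0.
rewrite pattern_rate_fin !lee_fin.
have bl : k%:R ^+ 2 * #|` lattice_boundary L|%:R * l <= e / 2 * #|` L|%:R.
  move: bL; rewrite mulrAC ler_pdivlMr// => bL.
  suff : #|` lattice_boundary L|%:R * (2 * k%:R ^+ 2 * l) <= e * #|` L|%:R by lra.
  apply: le_trans bL; rewrite ler_wpM2l// ler_wpM2l ?mulr_ge0 ?exprn_ge0//; lra.
split.
  set p : R := k%:R + M%:R; have p0 : 0 < p by rewrite ltr_wpDr.
  have := low k L k0; rewrite -/a natrM natrD -/p -expr2 => lo.
  have ba : #|` lattice_boundary L|%:R * a <= e / 2 * #|` L|%:R.
    apply: le_trans bl; rewrite -mulrA mulrCA; exact: ler_wpM2l.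
  (* With [a <= k ^ 2 * l] and [p ^ 2 - k ^ 2 <= 2 * M * p], the difference is at most
     [2 * M * l / p]. *)
  have gap : a / k%:R ^+ 2 - a / p ^+ 2 <= e / 2.
    have -> : a / k%:R ^+ 2 - a / p ^+ 2 = a * (p ^+ 2 - k%:R ^+ 2) / (k%:R ^+ 2 * p ^+ 2).
      by field; rewrite !gt_eqF.
    rewrite ler_pdivrMr ?mulr_gt0 ?exprn_gt0//.
    have s1 : p ^+ 2 - k%:R ^+ 2 <= 2 * M%:R * p by rewrite /p; nra.
    have s0 : 0 <= p ^+ 2 - k%:R ^+ 2 by rewrite /p; nra.
    have s2 : a * (p ^+ 2 - k%:R ^+ 2) <= k%:R ^+ 2 * l * (2 * M%:R * p).
      exact: ler_pM.
    apply: le_trans s2 _.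
    have kp : k%:R <= p by rewrite lerDl.
    have s3 : 4 * M%:R * l <= e * p by apply: le_trans kM _; rewrite ler_wpM2l// ltW.
    have q0 : 0 <= k%:R ^+ 2 * p by rewrite mulr_ge0 ?exprn_ge0// ltW.
    have := ler_wpM2l q0 s3; lra.
  rewrite ler_pdivlMr//.
  have lo' : #|` L|%:R * (a / p ^+ 2) <= lnG L + e / 2 * #|` L|%:R.
    rewrite mulrA ler_pdivrMr ?exprn_gt0// [leRHS]mulrC; apply: le_trans lo _.
    by rewrite ler_wpM2l ?exprn_ge0 ?(ltW p0)// lerD2l.
  have := ler_wpM2r (ltW cL) gap; lra.
rewrite ler_pdivrMr//.
have up := lnGamma_upper L k0; rewrite -/a -/l natrM -expr2 in up.
have k20 : 0 < k%:R ^+ 2 :> R by rewrite exprn_gt0.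
rewrite -(ler_pM2l k20); apply: le_trans up _.
have -> : k%:R ^+ 2 * ((a / k%:R ^+ 2 + e) * #|` L|%:R) =
  #|` L|%:R * a + k%:R ^+ 2 * (e * #|` L|%:R) by field; rewrite gt_eqF.
have eL0 : 0 <= k%:R ^+ 2 * (e * #|` L|%:R) by rewrite !mulr_ge0// ltW.
rewrite lerD2l; have := ler_wpM2l (ltW k20) bl; lra.
Qed.

End Bounds.

(** * Limits superior along a filter, for sequences and double sequences alike *)

Section LimitSup.
Context {R : realType} {T : choiceType} {X : filteredType T}.
Implicit Types (f : X -> \bar R) (F : set_system X) (c : \bar R).

Lemma limf_esup_le f F c : (\forall x \near F, f x <= c)%E -> (limf_esup f F <= c)%E.
Proof.
move=> fc; apply: ge_ereal_inf; exists (ereal_sup (f @` [set x | (f x <= c)%E])).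
  by exists [set x | (f x <= c)%E].
by apply: ge_ereal_sup => _ [x fx <-].
Qed.

Lemma limf_esup_ge f F c : ProperFilter F ->
  (\forall x \near F, c <= f x)%E -> (c <= limf_esup f F)%E.
Proof.
move=> FF cf; apply: le_ereal_inf_tmp => _ [V FV <-].
have [x [Vx cx]] := filter_ex (filterI FV cf).
by apply: le_trans cx _; apply: ereal_sup_ubound; exists x.
Qed.

Lemma limf_esup_near_le f F c : (limf_esup f F < c)%E -> Filter F ->
  (\forall x \near F, f x <= c)%E.
Proof.
move=> /ereal_inf_ltP[_ [V FV <-] Vc] FF; apply: filterS FV => x Vx.
by apply: le_trans (ltW Vc); apply: ereal_sup_ubound; exists x.
Qed.

End LimitSup.

(** * Comparison of the two entropies *)

(** The centre [c] may vary with [e], so its convergence never has to be studied. *)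
Lemma lee_near (R : realType) (u v : \bar R) :
  (forall e : R, 0 < e -> exists c : R, ((c - e)%:E <= v)%E /\ (u <= (c + e)%:E)%E) ->
  (u <= v)%E.
Proof.
move=> uv; apply/lee_addgt0Pr => e e0.
have [c [cv uc]] := uv _ (divr_gt0 e0 (ltr0Sn R 1)).
apply: le_trans uc _; rewrite (_ : c + _ = c - e / 2 + e); last lra.
by rewrite EFinD leeD2r.
Qed.

(** The ratio is at most [1 / m + 1 / n], hence at most [d] once both sides exceed [2 / d]. *)
Lemma boundary_rect_small (R : realType) (d : R) : 0 < d ->
  \forall mn \near filter_prod \oo \oo, rect_lattice mn.1 mn.2 (0, 0) != fset0 /\
    #|` lattice_boundary (rect_lattice mn.1 mn.2 (0, 0))|%:R
      <= d * #|` rect_lattice mn.1 mn.2 (0, 0)|%:R.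
Proof.
move=> d0; pose K := (Num.bound (2 / d)).+1.
exists ([set n | (K <= n)%N], [set n | (K <= n)%N]).
  by split; exists K.
move=> [m n] [/= Km Kn]; split; first by apply: rect_neq0; [apply: leq_trans Km|apply: leq_trans Kn].
have big i : (K <= i)%N -> 2 <= d * i%:R.
  move=> Ki; have b0 : 0 <= 2 / d by rewrite divr_ge0// ltW.
  rewrite mulrC -ler_pdivrMr//; apply/ltW/(lt_le_trans (archi_boundP b0)).
  by rewrite ler_nat ltnW.
apply: le_trans (_ : (m + n)%:R <= _); first by rewrite ler_nat boundary_rect.
rewrite card_rect natrM natrD.
have := ler_wpM2r (ler0n R n) (big m Km).
have := ler_wpM2r (ler0n R m) (big n Kn); lra.
Qed.

Theorem theorem1p2 (R : realType) (N : nat) (U : set (config N))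
    (Omega : nat -> {fset Z2}) :
  (2 <= N)%N ->
  additive_shift_space U ->
  block_gluing R U ->
  expanding_system Omega ->
  limn_esup (fun n =>
    ((#|` lattice_boundary (Omega n)|%:R / #|` Omega n|%:R : R)%:E)) = 0%E ->
  expanding_entropy R Omega U = rect_entropy R U.
Proof.
move=> _ [_ shiftU] glueU [neq0_Omega _ _] ratio0.
have OmegaF (d : R) : 0 < d -> \forall n \near \oo, Omega n != fset0 /\
    #|` lattice_boundary (Omega n)|%:R <= d * #|` Omega n|%:R.
  move=> d0; have lt : (limn_esup (fun n =>
    ((#|` lattice_boundary (Omega n)|%:R / #|` Omega n|%:R : R)%:E)) < d%:E)%E.
    by rewrite ratio0 lte_fin.
  (* Index 0 must be avoided, as [Omega 0] may be empty. *)
  near=> n; have nz : Omega n != fset0 by apply: neq0_Omega; near: n; exists 1%N.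
  split=> //; rewrite -ler_pdivrMr ?ltr0n ?cardfs_gt0// -lee_fin.
  by near: n; apply: limf_esup_near_le.
have PF : ProperFilter (filter_prod \oo \oo : set_system (nat * nat)).
  exact: filter_prod_proper.
(* For empty [U] both entropies are [-oo], because [lne 0 = -oo] and the sets are eventually
   nonempty. *)
have [U0|/set0P U0] := eqVneq U set0.
  have rateNy L : L != fset0 -> (pattern_rate R L U = -oo)%E.
    move=> L0; rewrite /pattern_rate (_ : Gamma L U = 0%N).
      by rewrite /= lexx mulrNy gtr0_sg ?mul1e// invr_gt0 ltr0n cardfs_gt0.
    by rewrite /Gamma /patterns U0 image_set0 fset_set0.
  transitivity (-oo%E : \bar R); last symmetry; apply/eqP; rewrite -leeNy_eq.
    apply: limf_esup_le; apply: filterS (OmegaF 1 ltr01) => n [L0 _].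
    by rewrite rateNy.
  apply: limf_esup_le; apply: filterS (boundary_rect_small (@ltr01 R)) => n [L0 _].
  by rewrite rateNy.
have close (T : choiceType) (X : filteredType T) (F : set_system X) (L : X -> {fset Z2}) (c e d : R) :
  ProperFilter F ->
  (forall L, L != fset0 -> #|` lattice_boundary L|%:R <= d * #|` L|%:R ->
    ((c - e)%:E <= pattern_rate R L U)%E /\ (pattern_rate R L U <= (c + e)%:E)%E) ->
  (\forall x \near F, L x != fset0 /\ #|` lattice_boundary (L x)|%:R <= d * #|` L x|%:R) ->
  ((c - e)%:E <= limf_esup (fun x => pattern_rate R (L x) U) F)%E /\
  (limf_esup (fun x => pattern_rate R (L x) U) F <= (c + e)%:E)%E.
  move=> FF cl nF; split; [apply: limf_esup_ge|apply: limf_esup_le];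
    by apply: filterS nF => x [L0 bL]; case: (cl _ L0 bL).
(* For each [e], both entropies lie within [e] of the same [c]. *)
apply/eqP; rewrite eq_le; apply/andP; split; apply: lee_near => e e0;
  have [c [d [d0 cl]]] := pattern_rate_close U0 shiftU glueU e0; exists c;
  have [? ?] := close _ _ _ _ _ _ _ _ cl (OmegaF d d0);
  by have [? ?] := close _ _ _ _ _ _ _ PF cl (boundary_rect_small d0).
Unshelve. all: by end_near.
Qed.
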